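(* Let $G$ be a finitely generated abstract group. Assume that (a) $G$ has either trivial virtual center or the unique root property; (b) $G$ has two isomorphic normal finite index subgroups $U$ and $V$ such that the quotients $G/U$ and $G/V$ have distinct multisets of composition factors. Then $\mathrm{AComm}(G)$ is a proper subgroup of $\mathrm{Comm}(G)$ and therefore $\mathrm{Comm}(G)$ is not simple.
   Context: The virtual center of a group $G$ is the set of elements $g\in G$ which centralize a finite index subgroup of $G$. $G$ has the unique root property if $g^n=h^n$ with $g,h\in G$ and $n\geq 1$ implies $g=h$. Composition factors are considered up to isomorphism and with multiplicity. $\mathrm{Comm}(G)$ is the group of equivalence classes $[f]$ of isomorphisms $f:A\to B$ between finite index subgroups of $G$, where two such isomorphisms are equivalent if they coincide on some finite index subgroup of $G$, with product $[f_1][f_2]=[f_1\circ f_2]$ (for $f_i:A_i\to B_i$, the composition is defined on $f_2^{-1}(B_2\cap A_1)$). For a finite index subgroup $H$ of $G$ there is a canonical homomorphism $\mathrm{Aut}(H)\to\mathrm{Comm}(G)$, $\phi\mapsto[\phi]$. $\mathrm{AComm}(G)$ is the subgroup of $\mathrm{Comm}(G)$ generated by the canonical images of the groups $\mathrm{Aut}(H)$, where $H$ ranges over all finite index subgroups of $G$. *)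

(* Defs.v *)
Set Warnings "-notation-overridden,-notation-incompatible-prefix".
From HB Require Import structures.
From mathcomp Require Import all_boot all_fingroup.
From mathcomp Require Import jordanholder.
From mathcomp Require Import boolp classical_sets functions cardinality.
Import generic_quotient.

Set Implicit Arguments.
Unset Strict Implicit.
Unset Printing Implicit Defensive.

Local Open Scope quotient_scope.
Local Open Scope group_scope.
Local Open Scope classical_set_scope.

Section Subgroups.
Variable G : groupType.
Implicit Types (H K : set G) (x y : G).

Definition subgroup H : Prop := group_closed (mem H).

Definition normal_subgroup H : Prop :=
  subgroup H /\ forall x h, H h -> H (h ^ x).

Definition left_coset H x : set G := [set x * h | h in H].

Definition finite_index H : Prop := finite_set (range (left_coset H)).

Lemma subgroupP H :
  subgroup H <-> [/\ H 1, forall x y, H x -> H y -> H (x * y)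
                   & forall x, H x -> H x^-1].
Proof.
split=> [gH|[H1 HM HV]].
  have HV x : H x -> H x^-1.
    by move=> /mem_set Hx; apply/set_mem; exact: (group_closedV gH).
  split=> // [|x y /mem_set Hx /mem_set Hy].
    by apply/set_mem; case: gH.
  by apply/set_mem; exact: (group_closedM gH).
split=> [|x y /set_mem Hx /set_mem Hy]; first exact: mem_set.
by apply: mem_set; apply: HM => //; exact: HV.
Qed.

Lemma subgroup1 H : subgroup H -> H 1.
Proof. by case/subgroupP. Qed.

Lemma subgroupM H x y : subgroup H -> H x -> H y -> H (x * y).
Proof. by case/subgroupP=> _ + _; apply. Qed.

Lemma subgroupV H x : subgroup H -> H x -> H x^-1.
Proof. by case/subgroupP=> _ _; apply. Qed.

Lemma subgroupT : subgroup [set: G].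
Proof. by apply/subgroupP. Qed.

Lemma subgroupI H K : subgroup H -> subgroup K -> subgroup (H `&` K).
Proof.
move=> gH gK; apply/subgroupP; split; first by split; exact: subgroup1.
  by move=> x y [? ?] [? ?]; split; exact: subgroupM.
by move=> x [? ?]; split; exact: subgroupV.
Qed.

Lemma finite_indexP H : subgroup H ->
  finite_index H <-> exists s : seq G, forall x, exists2 y, y \in s & H (y^-1 * x).
Proof.
move=> gH; split=> [/finite_seqP[s sP]|[s sP]].
  exists [seq xget 1 A | A <- s] => x.
  have xs : left_coset H x \in s.
    by have : range (left_coset H) (left_coset H x) by []; rewrite sP.
  exists (xget 1 (left_coset H x)); first exact: map_f.
  case: xgetP => [y _ [h Hh <-]|/(_ x)[]].
    by rewrite invgM mulgVK; exact: subgroupV.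
  by exists 1; rewrite ?mulg1//; exact: subgroup1.
apply: (@sub_finite_set _ _ (left_coset H @` [set` s])); last first.
  by apply: finite_image; exact: finite_seq.
move=> _ [x _ <-]; have [y ys Hyx] := sP x; exists y => //.
apply/seteqP; split=> _ [h Hh <-].
  exists (x^-1 * y * h); last by rewrite !mulgA mulgV mul1g.
  apply: subgroupM => //; have -> : x^-1 * y = (y^-1 * x)^-1.
    by rewrite invgM invgK.
  exact: subgroupV.
exists (y^-1 * x * h); last by rewrite !mulgA mulgV mul1g.
exact: subgroupM.
Qed.

Lemma finite_indexT : finite_index [set: G].
Proof.
by apply/(finite_indexP subgroupT); exists [:: 1] => x; exists 1; rewrite ?mem_head.
Qed.

Lemma finite_indexI H K : subgroup H -> subgroup K ->
  finite_index H -> finite_index K -> finite_index (H `&` K).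
Proof.
move=> gH gK fH fK.
pose f (AB : set G * set G) := AB.1 `&` AB.2.
apply: (@sub_finite_set _ _
  (f @` (range (left_coset H) `*` range (left_coset K)))); last first.
  by apply: finite_image; exact: finite_setX.
move=> _ [x _ <-]; exists (left_coset H x, left_coset K x); first by split; exists x.
apply/seteqP; split=> y /=.
  by move=> [[h Hh <-] [k Kk /mulgI kh]]; exists h => //; split; rewrite // -kh.
by move=> [h [Hh Kh] <-]; split; exists h.
Qed.

Lemma finite_indexS H K : H `<=` K -> subgroup H -> subgroup K ->
  finite_index H -> finite_index K.
Proof.
move=> HK gH gK /(finite_indexP gH)[s sP]; apply/(finite_indexP gK).
by exists s => x; have [y ys /HK] := sP x; exists y.
Qed.

End Subgroups.

Section Properties.
Variable G : groupType.

Definition finitely_generated : Prop :=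
  exists2 X : set G, finite_set X & smallest (@subgroup G) X = [set: G].

Definition virtual_center : set G :=
  [set g | exists H : set G,
     [/\ subgroup H, finite_index H & forall h, H h -> commute g h]].

Definition unique_root_property : Prop :=
  forall (g h : G) (n : nat), (1 <= n)%N -> g ^+ n = h ^+ n -> g = h.

Definition simple_group : Prop :=
  (exists g : G, g <> 1) /\
  forall N : set G, normal_subgroup N -> N = [set 1] \/ N = [set: G].

Definition proper_subgroup (H : set G) : Prop :=
  subgroup H /\ H `<` [set: G].

(* f represents an isomorphism A -> B; its values outside A are irrelevant. *)
Definition iso_on (A B : set G) (f : G -> G) : Prop :=
  set_bij A B f /\ {in A &, {morph f : x y / x * y}}.

Definition isomorphic (A B : set G) : Prop := exists f, iso_on A B f.

Lemma smallest_subgroup (X : set G) : subgroup (smallest (@subgroup G) X).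
Proof.
apply/subgroupP; split=> [A [gA _]|x y Ax Ay A [gA XA]|x Ax A [gA XA]].
- exact: subgroup1.
- by apply: subgroupM => //; [exact: Ax|exact: Ay].
- by apply: subgroupV => //; exact: Ax.
Qed.

End Properties.

Arguments finitely_generated : clear implicits.
Arguments virtual_center : clear implicits.
Arguments unique_root_property : clear implicits.
Arguments simple_group : clear implicits.

Record fiSubgroup (G : groupType) := FISubgroup {
  fi_set :> set G;
  fi_subgroup : subgroup fi_set;
  fi_index : finite_index fi_set }.

Record fiNormal (G : groupType) := FINormal {
  fin_set :> set G;
  fin_normal : normal_subgroup fin_set;
  fin_index : finite_index fin_set }.

Section Quotient.
Variables (G : groupType) (U : fiNormal G).
Implicit Types x y : G.

Let gU : subgroup U. Proof. by case: (fin_normal U). Qed.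

Definition coset_rel x y : bool := `[< fin_set U (x^-1 * y) >].

Lemma coset_rel_equiv : equiv_class_of coset_rel.
Proof.
split=> [x|x y|y x z].
- by apply/asboolP; rewrite mulVg; exact: subgroup1.
- by apply/asboolP/asboolP => /(subgroupV gU); rewrite invgM invgK.
- move=> /asboolP Uxy /asboolP Uyz; apply/asboolP.
  by have := subgroupM gU Uxy Uyz; rewrite mulgA mulgK.
Qed.

Canonical coset_equiv := EquivRelPack coset_rel_equiv.

Definition quot := {eq_quot coset_equiv}.

HB.instance Definition _ := Choice.on quot.
HB.instance Definition _ := EqQuotient.on quot.

Definition quot_pi x : quot := \pi_quot x.

Lemma quot_piP x y : quot_pi x = quot_pi y <-> fin_set U (x^-1 * y).
Proof.
split=> [/eqP|Uxy]; first by rewrite /quot_pi eqmodE => /asboolP.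
by apply/eqP; rewrite /quot_pi eqmodE; exact/asboolP.
Qed.

Lemma quot_reprK (a : quot) : quot_pi (repr a) = a.
Proof. exact: reprK. Qed.

Definition quot_one : quot := quot_pi 1.
Definition quot_mul (a b : quot) : quot := quot_pi (repr a * repr b).
Definition quot_inv (a : quot) : quot := quot_pi (repr a)^-1.

Let UJ x h : fin_set U h -> fin_set U (h ^ x). Proof. by case: (fin_normal U) => _; apply. Qed.

Lemma quot_mulE x y : quot_mul (quot_pi x) (quot_pi y) = quot_pi (x * y).
Proof.
apply/quot_piP; set x' := repr _; set y' := repr _.
have /quot_piP Ux : quot_pi x' = quot_pi x by exact: quot_reprK.
have /quot_piP Uy : quot_pi y' = quot_pi y by exact: quot_reprK.
have -> : (x' * y')^-1 * (x * y) = (x'^-1 * x) ^ y' * (y'^-1 * y).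
  by rewrite conjgE invgM !mulgA mulgK.
by apply: subgroupM => //; exact: UJ.
Qed.

Lemma quot_invE x : quot_inv (quot_pi x) = quot_pi x^-1.
Proof.
apply/quot_piP; set x' := repr _.
have /quot_piP Ux : quot_pi x = quot_pi x' by rewrite quot_reprK.
have -> : x'^-1^-1 * x^-1 = (x^-1 * x') ^ x^-1.
  by rewrite conjgE !invgK !mulgA mulgV mul1g.
exact: UJ.
Qed.

Lemma quot_mulA : associative quot_mul.
Proof.
by move=> a b c; rewrite -(quot_reprK a) -(quot_reprK b) -(quot_reprK c)
  !quot_mulE mulgA.
Qed.

Lemma quot_mul1 : left_id quot_one quot_mul.
Proof. by move=> a; rewrite -(quot_reprK a) quot_mulE mul1g. Qed.

Lemma quot_mulV : left_inverse quot_one quot_inv quot_mul.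
Proof. by move=> a; rewrite -(quot_reprK a) quot_invE quot_mulE mulVg. Qed.

Lemma quot_finite : exists s : seq quot, forall a, a \in s.
Proof.
have [s sP] := (finite_indexP gU).1 (fin_index U).
exists (map quot_pi s) => a; have [y ys Uya] := sP (repr a).
by apply/mapP; exists y => //; rewrite -(quot_reprK a); apply/esym/quot_piP.
Qed.

Definition quot_enum : seq quot := undup (projT1 (cid quot_finite)).

Lemma mem_quot_enum a : a \in quot_enum.
Proof. by rewrite mem_undup; exact: (projT2 (cid quot_finite)). Qed.

Lemma quot_enumP : Finite.axiom quot_enum.
Proof. by move=> a; rewrite count_uniq_mem ?undup_uniq// mem_quot_enum. Qed.

Lemma quot_pickleK : pcancel (index^~ quot_enum) (onth quot_enum).
Proof.
move=> a; have ain := mem_quot_enum a.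
by rewrite onthE (nth_map a) ?index_mem// nth_index.
Qed.

HB.instance Definition _ := isCountable.Build quot quot_pickleK.
HB.instance Definition _ := isFinite.Build quot quot_enumP.
HB.instance Definition _ :=
  Finite_isGroup.Build quot quot_mulA quot_mul1 quot_mulV.

Lemma quot_piM x y : (quot_pi x * quot_pi y)%g = quot_pi (x * y).
Proof. exact: quot_mulE. Qed.

End Quotient.

Definition comp_series (gT : finGroupType) : seq {group gT} :=
  xchoose (exists_comps [set: gT]%G).

(* The multiset of composition factors up to isomorphism, as a multiplicity
   function; by Jordan-Hoelder it does not depend on the chosen series. *)
Definition comp_factors (gT : finGroupType) (S : finGroupType) : nat :=
  count (fun s : section gT => s \isog [set: S]%G)
        (pairmap (@mkSec gT) [set: gT]%G (comp_series gT)).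

Section Isomorphisms.
Variable G : groupType.
Implicit Types (A B C : set G) (f : G -> G).

Lemma iso_onT : iso_on [set: G] [set: G] idfun.
Proof. by split=> //; split=> // x _; exists x. Qed.

Lemma iso_on_inj A B f x y : iso_on A B f -> A x -> A y -> f x = f y -> x = y.
Proof. by move=> [[_ fI _] _] Ax Ay; apply: fI; exact: mem_set. Qed.

Lemma iso_onM A B f x y : iso_on A B f -> A x -> A y -> f (x * y) = f x * f y.
Proof. by move=> [_ fM] Ax Ay; apply: fM; exact: mem_set. Qed.

Lemma iso_on1 A B f : subgroup A -> iso_on A B f -> f 1 = 1.
Proof.
move=> gA fi; apply: (mulgI (f 1)).
by rewrite -(iso_onM fi) ?mulg1//; exact: subgroup1.
Qed.

Lemma iso_onV A B f x : subgroup A -> iso_on A B f -> A x -> f x^-1 = (f x)^-1.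
Proof.
move=> gA fi Ax; apply: (mulgI (f x)).
by rewrite -(iso_onM fi) ?mulgV ?(iso_on1 gA fi)//; exact: subgroupV.
Qed.

Lemma iso_on_sub A B C f : C `<=` A -> iso_on A B f -> iso_on C (f @` C) f.
Proof.
move=> CA fi; split=> [|x y /set_mem/CA Ax /set_mem/CA Ay]; last exact: (iso_onM fi).
split; [by move=> x Cx; exists x| |by []].
by move=> x y /set_mem/CA Ax /set_mem/CA Ay; exact: (iso_on_inj fi).
Qed.

Lemma iso_on_comp A B C f g : iso_on A B g -> iso_on B C f -> iso_on A C (f \o g).
Proof.
move=> [gb gM] [fb fM]; split; first exact: set_bij_comp gb fb.
move=> x y Ax Ay /=; rewrite gM// fM//; apply: mem_set.
  by case: gb => gf _ _; apply: gf; exact: set_mem.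
by case: gb => gf _ _; apply: gf; exact: set_mem.
Qed.

Lemma image_subgroup A B C f : subgroup A -> iso_on A B f ->
  subgroup C -> C `<=` A -> subgroup (f @` C).
Proof.
move=> gA fi gC CA; apply/subgroupP; split.
- by exists 1; [exact: subgroup1|exact: (iso_on1 gA fi)].
- move=> _ _ [x Cx <-] [y Cy <-]; exists (x * y); first exact: subgroupM.
  by apply: (iso_onM fi); exact: CA.
- move=> _ [x Cx <-]; exists x^-1; first exact: subgroupV.
  by apply: (iso_onV gA fi); exact: CA.
Qed.

Lemma image_finite_index A B C f : subgroup A -> subgroup B -> iso_on A B f ->
  finite_index B -> subgroup C -> C `<=` A -> finite_index C ->
  finite_index (f @` C).
Proof.
move=> gA gB fi /(finite_indexP gB)[s sP] gC CA /(finite_indexP gC)[t tP].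
apply/(finite_indexP (image_subgroup gA fi gC CA)).
exists [seq y * f a | y <- s, a <- t] => x.
have [y ys Byx] := sP x; case: (fi) => -[_ _ fS] _.
have [a Aa fa] := fS _ Byx; have [b bt Cba] := tP a.
exists (y * f b); first by apply/allpairsP; exists (y, b).
have Ab : A b.
  have -> : b = a * (b^-1 * a)^-1 by rewrite invgM invgK mulgA mulgV mul1g.
  by apply: subgroupM => //; apply: subgroupV => //; exact: CA.
exists (b^-1 * a) => //.
by rewrite (iso_onM fi) ?(iso_onV gA fi)// ?fa ?invgM ?mulgA//; exact: subgroupV.
Qed.

Definition iso_inv A f : G -> G := 'pinv_(fun=> 1) A f.

Lemma iso_invK A B f x : iso_on A B f -> A x -> iso_inv A f (f x) = x.
Proof. by move=> [[_ fI _] _] Ax; apply: pinvKV => //; exact: mem_set. Qed.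

Lemma iso_invKV A B f y : iso_on A B f -> B y -> f (iso_inv A f y) = y.
Proof. by move=> [[_ _ fS] _] By; apply: (surjpK _ fS); exact: mem_set. Qed.

Lemma iso_inv_iso A B f : subgroup A -> iso_on A B f -> iso_on B A (iso_inv A f).
Proof.
move=> gA fi; case: (fi) => fb _.
have fb' := bijpinv_bij (fun=> 1) fb; split=> // x y /set_mem Bx /set_mem By.
case: (fb) => _ _ fS; have [a Aa <-] := fS _ Bx; have [b Ab <-] := fS _ By.
by rewrite -(iso_onM fi)// !(iso_invK fi)//; exact: subgroupM.
Qed.

Definition preim_on A C f : set G := [set x | A x /\ C (f x)].

Lemma preim_onE A B C f : iso_on A B f ->
  preim_on A C f = iso_inv A f @` (B `&` C).
Proof.
move=> fi; have [[fF _ fS] _] := fi; apply/seteqP; split=> [x [Ax Cfx]|].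
  by exists (f x); [split=> //; exact: fF|exact: (iso_invK fi)].
move=> _ [y [By Cy] <-]; split; last by rewrite (iso_invKV fi).
by have [a Aa <-] := fS _ By; rewrite (iso_invK fi).
Qed.

Lemma preim_on_subgroup A B C f : subgroup A -> subgroup B -> subgroup C ->
  iso_on A B f -> subgroup (preim_on A C f).
Proof.
move=> gA gB gC fi; rewrite (preim_onE _ fi).
apply: (image_subgroup gB (iso_inv_iso gA fi)); first exact: subgroupI.
exact: subIsetl.
Qed.

Lemma preim_on_finite_index A B C f : subgroup A -> subgroup B -> subgroup C ->
  finite_index A -> finite_index B -> finite_index C ->
  iso_on A B f -> finite_index (preim_on A C f).
Proof.
move=> gA gB gC fA fB fC fi; rewrite (preim_onE _ fi).
have gBC := subgroupI gB gC; have fBC := finite_indexI gB gC fB fC.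
exact: (image_finite_index gB gA (iso_inv_iso gA fi) fA gBC (@subIsetl _ B C) fBC).
Qed.

End Isomorphisms.

Definition fiT (G : groupType) : fiSubgroup G :=
  FISubgroup (@subgroupT G) (@finite_indexT G).

Definition fiI (G : groupType) (A B : fiSubgroup G) : fiSubgroup G :=
  FISubgroup (subgroupI (fi_subgroup A) (fi_subgroup B))
    (finite_indexI (fi_subgroup A) (fi_subgroup B) (fi_index A) (fi_index B)).

Record virtual_aut (G : groupType) := VirtualAut {
  va_dom : fiSubgroup G;
  va_cod : fiSubgroup G;
  va_fun :> G -> G;
  va_iso : iso_on va_dom va_cod va_fun }.

HB.instance Definition _ (G : groupType) := gen_eqMixin (virtual_aut G).
HB.instance Definition _ (G : groupType) := gen_choiceMixin (virtual_aut G).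

Section VirtualAut.
Variable G : groupType.
Implicit Types (f g h : virtual_aut G) (C : fiSubgroup G).

Definition va_preim f C : fiSubgroup G :=
  FISubgroup
    (preim_on_subgroup (fi_subgroup (va_dom f)) (fi_subgroup (va_cod f))
       (fi_subgroup C) (va_iso f))
    (preim_on_finite_index (fi_subgroup (va_dom f)) (fi_subgroup (va_cod f))
       (fi_subgroup C) (fi_index (va_dom f)) (fi_index (va_cod f))
       (fi_index C) (va_iso f)).

Definition va_one : virtual_aut G :=
  @VirtualAut G (fiT G) (fiT G) idfun (iso_onT G).

Definition va_inv f : virtual_aut G :=
  VirtualAut (iso_inv_iso (fi_subgroup (va_dom f)) (va_iso f)).

Section Restriction.
Variables (f : virtual_aut G) (C : fiSubgroup G).
Hypothesis CA : fi_set C `<=` va_dom f.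

Definition va_image : fiSubgroup G :=
  FISubgroup
    (image_subgroup (fi_subgroup (va_dom f)) (va_iso f) (fi_subgroup C) CA)
    (image_finite_index (fi_subgroup (va_dom f)) (fi_subgroup (va_cod f))
       (va_iso f) (fi_index (va_cod f)) (fi_subgroup C) CA (fi_index C)).

Definition va_res : virtual_aut G :=
  @VirtualAut G C va_image f (iso_on_sub CA (va_iso f)).

End Restriction.

Section Composition.
Variables f g : virtual_aut G.

Let D : fiSubgroup G := va_preim g (va_dom f).

Let Dg : fi_set D `<=` va_dom g. Proof. by move=> x []. Qed.

Let Ef : fi_set (va_image Dg) `<=` va_dom f.
Proof. by move=> _ [x [_ ?] <-]. Qed.

Definition va_comp : virtual_aut G :=
  @VirtualAut G D (va_image Ef) (f \o g)
    (iso_on_comp (va_iso (va_res Dg)) (va_iso (va_res Ef))).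

End Composition.

Definition va_rel f g : bool :=
  `[< exists C, [/\ fi_set C `<=` va_dom f, fi_set C `<=` va_dom g
                  & forall x, fi_set C x -> f x = g x] >].

Lemma va_rel_equiv : equiv_class_of va_rel.
Proof.
split=> [f|f g|g f h].
- by apply/asboolP; exists (va_dom f); split.
- by apply/asboolP/asboolP => -[C [Cf Cg fg]]; exists C; split=> // x /fg ->.
- move=> /asboolP[C [Cf Cg fg]] /asboolP[D [Dg Dh gh]]; apply/asboolP.
  exists (fiI C D); split; [by move=> x [/Cf]|by move=> x [_ /Dh]|].
  by move=> x [/fg -> /gh].
Qed.

Canonical va_equiv := EquivRelPack va_rel_equiv.

Definition Comm := {eq_quot va_equiv}.

HB.instance Definition _ := Choice.on Comm.
HB.instance Definition _ := EqQuotient.on Comm.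

Definition comm_class f : Comm := \pi_Comm f.

Lemma comm_classP f g : comm_class f = comm_class g <->
  exists C, [/\ fi_set C `<=` va_dom f, fi_set C `<=` va_dom g
               & forall x, fi_set C x -> f x = g x].
Proof.
split=> [/eqP|fg]; first by rewrite /comm_class eqmodE => /asboolP.
by apply/eqP; rewrite /comm_class eqmodE; exact/asboolP.
Qed.

Lemma comm_reprK (a : Comm) : comm_class (repr a) = a.
Proof. exact: reprK. Qed.

Definition comm_one : Comm := comm_class va_one.
Definition comm_mul (a b : Comm) : Comm := comm_class (va_comp (repr a) (repr b)).
Definition comm_inv (a : Comm) : Comm := comm_class (va_inv (repr a)).

Lemma comm_mulE f g :
  comm_mul (comm_class f) (comm_class g) = comm_class (va_comp f g).
Proof.
apply/comm_classP; set f' := repr _; set g' := repr _.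
have /comm_classP[C [Cf Cf' ff']] : comm_class f = comm_class f'.
  by rewrite comm_reprK.
have /comm_classP[D [Dg Dg' gg']] : comm_class g = comm_class g'.
  by rewrite comm_reprK.
exists (fiI D (va_preim g C)); split=> x /= [Dx [_ Cgx]].
- by split; [exact: Dg'|rewrite -gg'//; exact: Cf'].
- by split; [exact: Dg|exact: Cf].
- by rewrite -gg'// ff'.
Qed.

Lemma comm_mulA : associative comm_mul.
Proof.
move=> a b c; rewrite -(comm_reprK a) -(comm_reprK b) -(comm_reprK c) !comm_mulE.
apply/comm_classP; set f := repr a; set g := repr b; set h := repr c.
exists (va_dom (va_comp f (va_comp g h))); split=> //.
by move=> x /= [[? ?] ?].
Qed.

Lemma comm_mul1 : left_id comm_one comm_mul.
Proof.
move=> a; rewrite -(comm_reprK a) comm_mulE; apply/comm_classP.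
by exists (va_dom (repr a)); split.
Qed.

Lemma comm_1mul : right_id comm_one comm_mul.
Proof.
move=> a; rewrite -(comm_reprK a) comm_mulE; apply/comm_classP.
by exists (va_dom (repr a)); split.
Qed.

Lemma comm_mulV : left_inverse comm_one comm_inv comm_mul.
Proof.
move=> a; rewrite -{2}(comm_reprK a) comm_mulE; apply/comm_classP.
set f := repr a; exists (va_dom f); split=> // x fx.
  by split=> //=; have [[fF _ _] _] := va_iso f; exact: fF.
exact: (iso_invK (va_iso f)).
Qed.

Lemma comm_Vmul : right_inverse comm_one comm_inv comm_mul.
Proof.
move=> a; rewrite -{1}(comm_reprK a) comm_mulE; apply/comm_classP.
set f := repr a; exists (va_cod f); split=> // x fx.
  split=> //=; have [[gF _ _] _] := va_iso (va_inv f); exact: gF.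
exact: (iso_invKV (va_iso f)).
Qed.

HB.instance Definition _ :=
  isGroup.Build Comm comm_mulA comm_mul1 comm_1mul comm_mulV comm_Vmul.

Definition Aut_image (H : fiSubgroup G) : set Comm :=
  [set a | exists (phi : G -> G) (phi_aut : iso_on H H phi),
             a = comm_class (VirtualAut phi_aut)].

Definition AComm : set Comm :=
  smallest (@subgroup Comm) (\bigcup_(H : fiSubgroup G) Aut_image H).

Lemma comm_classM f g :
  (comm_class f * comm_class g)%g = comm_class (va_comp f g).
Proof. exact: comm_mulE. Qed.

End VirtualAut.

Arguments Comm : clear implicits.
Arguments AComm : clear implicits.

(* Main.v *)
Require Import Defs.
From mathcomp Require Import all_boot all_fingroup.
From mathcomp Require Import boolp classical_sets.
From mathcomp Require Import ssralg ssrnum ssrint intdiv generic_quotient gseries jordanholder.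
From mathcomp Require Import zify.

Import GRing.Theory Num.Theory.

(** Composition factors give a refined index.  For a finite simple group S and
    a finite index subgroup A of G, let d(A) be the multiplicity of S in G/K
    minus its multiplicity in A/K, where K is a finite index normal subgroup of
    G inside A; for normal A this is the multiplicity of S in G/A.  Like the
    logarithm of the index, d has two properties: it does not depend on K, and
    the difference d(C) - d(A), for C inside A, depends only on the pair
    (A, C), so that every isomorphism A -> B preserves it
    ([factor_index_iso]).

    Both follow from [multiplicity_exchange].  If phi and psi are homomorphisms
    from A to finite groups whose kernels lie in C, then
    mult(phi A) - mult(phi C) = mult(psi A) - mult(psi C), since each side can
    be computed with the joint homomorphism (phi, psi), the kernel of either
    coordinate contributing equally to A and to C.  What is used about finite
    groups is that multiplicities add up along a morphism
    ([multiplicity_morphism]), a consequence of the Jordan-Hoelder theorem.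

    Hence [f : A -> B] |-> d(B) - d(A) is a well-defined homomorphism
    chi : Comm(G) -> Z ([factor_ratio], [factor_ratioM]).  It vanishes on every
    Aut(H), hence on AComm(G).  For isomorphic normal subgroups U and V whose
    quotients contain S with different multiplicities, an isomorphism U -> V
    has a nonzero image, so AComm(G) is proper.  Finally, a group H with a
    homomorphism chi to Z such that n = chi(u) is nonzero is never simple: the
    preimage of 2nZ is normal, misses u, and contains u^2, which is nontrivial
    because chi(u^2) = 2n. *)

(** * Multiplicities of composition factors of finite groups *)

Set Implicit Arguments.
Unset Strict Implicit.
Unset Printing Implicit Defensive.

Section Multiplicity.
Variable S : finGroupType.
Local Open Scope group_scope.

(** On the full group this unfolds to [comp_factors]; arbitrary subgroups are
    allowed so that one can induct inside a fixed finite group. *)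
Definition multiplicity (gT : finGroupType) (H : {group gT}) : nat :=
  count (fun s : section gT => s \isog [set: S]%G)
        (pairmap (@mkSec gT) H (xchoose (exists_comps H))).

Lemma multiplicity_comps (gT : finGroupType) (H : {group gT}) s :
  comps H s ->
  multiplicity H = count (fun s : section gT => s \isog [set: S]%G)
                         (pairmap (@mkSec gT) H s).
Proof.
move=> cs; have /seq.permP perm_fact :=
  JordanHolderUniqueness (xchooseP (exists_comps H)) cs.
have := perm_fact (fun s : section gT => s \isog [set: S]%G).
rewrite !count_map.
have eq_repr : preim (@section_repr gT) (fun s => s \isog [set: S]%G)
            =1 (fun s : section gT => s \isog [set: S]%G).
  move=> x /=; exact: (isog_transl _ (section_reprP x)).
by rewrite !(eq_count eq_repr).
Qed.

Lemma multiplicity1 (gT : finGroupType) : multiplicity [1 gT]%G = 0%N.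
Proof. by rewrite (@multiplicity_comps _ _ [::]) // /comps eqxx. Qed.

Lemma multiplicity_maxnormal (gT : finGroupType) (H M : {group gT}) :
  maxnormal M H H ->
  multiplicity H = ((H / M) \isog [set: S] : nat) + multiplicity M.
Proof.
move=> maxM; have [s cs] := exists_comps M.
rewrite (multiplicity_comps cs) (@multiplicity_comps _ _ (M :: s)) //.
by case/andP: cs => ls ps; rewrite /comps ls /= maxM.
Qed.

(** Induction on the image: a maximal normal subgroup M of the image pulls back
    to a maximal normal subgroup P of H with the same simple quotient, and the
    restriction of f to P has image M and an unchanged kernel. *)
Lemma multiplicity_morphism (aT rT : finGroupType) (D H : {group aT})
    (f : {morphism D >-> rT}) : H \subset D ->
  multiplicity H = (multiplicity (f @* H) + multiplicity ('ker_H f))%N.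
Proof.
have [n] := ubnP #|f @* H|; elim: n H => // n IHn H leHn sHD.
have [fH1|ntfH] := eqVneq (f @* H) 1.
  have -> : (f @* H)%G = 1%G by apply: val_inj.
  have -> : ('ker_H f)%G = H.
    apply: val_inj; rewrite /= (finset.setIidPl _) //.
    by rewrite ker_trivg_morphim sHD fH1 subxx.
  by rewrite multiplicity1.
have [M maxM] := ex_maxnormal_ntrivg ntfH.
have nMfH := maxnormal_normal maxM.
pose P := (H :&: f @*^-1 M)%G.
have fP : (f @* P)%G = M.
  by apply: val_inj; rewrite /= morphim_setIpre (finset.setIidPr (normal_sub nMfH)).
have kerP : ('ker_P f)%G = ('ker_H f)%G.
  by apply: val_inj; rewrite /= -finset.setIA (finset.setIidPr (ker_sub_pre f M)).
have sHN : H \subset f @*^-1 'N(M).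
  by rewrite -sub_morphim_pre // normal_norm.
have kerHM : 'ker_H (coset M \o f) = P.
  by rewrite ker_comp ker_coset.
have isoP : H / P \isog (f @* H) / M.
  have := first_isog_loc [morphism of coset M \o f] sHN.
  by rewrite /= kerHM morphim_comp.
have nPH : P <| H.
  by rewrite /= -kerHM; exact: normalGI sHN (ker_normal _).
have maxP : maxnormal P H H.
  by rewrite -quotient_simple // (isog_simple isoP) quotient_simple.
rewrite (multiplicity_maxnormal maxP) (multiplicity_maxnormal maxM).
rewrite (isog_transl _ isoP) -addnA; congr (_ + _)%N.
have ltfP : #|f @* P| < n.
  rewrite -ltnS (leq_trans _ leHn) // ltnS.
  have -> : f @* P = M := congr1 val fP.
  exact: proper_card (maxnormal_proper maxM).
have sPD : P \subset D by exact: fintype.subset_trans (finset.subsetIl _ _) sHD.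
by rewrite (IHn P ltfP sPD) fP kerP.
Qed.
End Multiplicity.

(** * Homomorphisms from a subgroup of an infinite group to finite groups *)

Section ImageGroup.
Variable G : groupType.
Local Open Scope group_scope.
Local Open Scope classical_set_scope.

Definition hom_on (A : set G) (gT : finGroupType) (phi : G -> gT) : Prop :=
  forall x y, A x -> A y -> phi (x * y) = phi x * phi y.

(** Taking the generated subgroup yields a group for every phi and A; it is
    the plain image when phi is a homomorphism on the subgroup A
    ([mem_image_group]). *)
Definition image_group (gT : finGroupType) (phi : G -> gT) (A : set G) :
    {group gT} :=
  <<finset (fun y => `[< (phi @` A) y >])>>%G.

Lemma hom_onS (A B : set G) (gT : finGroupType) (phi : G -> gT) :
  A `<=` B -> hom_on B phi -> hom_on A phi.
Proof. by move=> sAB hB x y /sAB Bx /sAB By; exact: hB. Qed.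

Lemma hom_on1 (A : set G) (gT : finGroupType) (phi : G -> gT) :
  subgroup A -> hom_on A phi -> phi 1 = 1.
Proof.
move=> gA hA; apply: (mulgI (phi 1)).
by rewrite -hA ?mulg1 //; exact: subgroup1.
Qed.

Lemma mem_image_group (A : set G) (gT : finGroupType) (phi : G -> gT) y :
  subgroup A -> hom_on A phi ->
  reflect (exists2 x, A x & phi x = y) (y \in image_group phi A).
Proof.
move=> gA hA; rewrite /= gen_set_id; first by rewrite inE; exact: asboolP.
apply/group_setP; split=> [|u v].
  by rewrite inE; apply/asboolP; exists 1; [exact: subgroup1|exact: (hom_on1 gA hA)].
rewrite inE => /asboolP[x Ax <-]; rewrite inE => /asboolP[z Az <-]; rewrite inE.
by apply/asboolP; exists (x * z); [exact: subgroupM|exact: hA].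
Qed.

Lemma eq_image_group (gT : finGroupType) (A B : set G) (phi psi : G -> gT) :
  phi @` A = psi @` B -> image_group phi A = image_group psi B.
Proof. by rewrite /image_group => ->. Qed.

Lemma subgroup_ker (A : set G) (gT : finGroupType) (phi : G -> gT) :
  subgroup A -> hom_on A phi -> subgroup (A `&` [set x | phi x = 1]).
Proof.
move=> gA hA; apply/subgroupP; split.
- by split; [exact: subgroup1|exact: (hom_on1 gA hA)].
- move=> x y [Ax /= x1] [Ay /= y1].
  by split; [exact: subgroupM|rewrite /= hA // x1 y1 mulg1].
- move=> x [Ax /= x1]; have AVx := subgroupV gA Ax.
  split=> //=; apply: (mulgI (phi x)).
  by rewrite -hA // mulgV x1 mulg1 (hom_on1 gA hA).
Qed.

(** Additivity of multiplicities, read on the source A instead of on its finite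
    image.  Only f varies when the two projections of a product are compared,
    which is why chi is kept apart from f. *)
Lemma multiplicity_image (S Q R : finGroupType) (chi : G -> Q)
    (f : {morphism [set: Q]%SET >-> R}) (A : set G) :
    subgroup A -> hom_on A chi ->
  multiplicity S (image_group chi A) =
  (multiplicity S (image_group (f \o chi) A) +
   multiplicity S (image_group chi (A `&` [set x | f (chi x) = 1%g])))%N.
Proof.
move=> gA hchi.
have hf : hom_on A (f \o chi).
  by move=> x y Ax Ay; rewrite /= hchi // morphM ?inE.
rewrite (multiplicity_morphism S f) ?finset.subsetT //.
congr (_ + _)%N; congr (multiplicity _ _); apply/val_inj/setP => y /=.
  apply/idP/idP => [/morphimP[z _ /(mem_image_group _ gA hchi)[x Ax <-] ->]|].
    by apply/(mem_image_group _ gA hf); exists x.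
  case/(mem_image_group _ gA hf) => x Ax <-.
  apply/morphimP; exists (chi x); rewrite ?inE //.
  by apply/(mem_image_group _ gA hchi); exists x.
have gK := subgroup_ker gA hf.
have hK : hom_on (A `&` [set x | f (chi x) = 1]) chi.
  by apply: hom_onS hchi => x [].
apply/idP/idP.
  rewrite inE => /andP[/(mem_image_group _ gA hchi)[x Ax <-]].
  rewrite !inE /= => /eqP x1.
  by apply/(mem_image_group _ gK hK); exists x.
case/(mem_image_group _ gK hK) => x [Ax /= x1] <-.
rewrite inE; apply/andP; split; last by rewrite !inE /= x1.
by apply/(mem_image_group _ gA hchi); exists x.
Qed.

End ImageGroup.

(** * The refined index of a finite index subgroup *)

Section Independence.
Variables (S : finGroupType) (G : groupType).
Local Open Scope group_scope.
Local Open Scope classical_set_scope.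

(** In terms of differences: mult(phi A) - mult(phi B) does not depend on the
    homomorphism phi, as long as its kernel on A lies in B.  Compare phi and
    psi with chi = (phi, psi): passing from chi to a coordinate removes the
    contribution of the kernel of that coordinate, which is the same for A and
    for B because this kernel lies in B. *)
Lemma multiplicity_exchange (Q R : finGroupType) (phi : G -> Q) (psi : G -> R)
    (A B : set G) :
    subgroup A -> subgroup B -> B `<=` A -> hom_on A phi -> hom_on A psi ->
    (forall x, A x -> phi x = 1 -> B x) -> (forall x, A x -> psi x = 1 -> B x) ->
  (multiplicity S (image_group phi A) + multiplicity S (image_group psi B) =
   multiplicity S (image_group psi A) + multiplicity S (image_group phi B))%N.
Proof.
move=> gA gB sBA hphi hpsi kphi kpsi.
have hphiB := hom_onS sBA hphi; have hpsiB := hom_onS sBA hpsi.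
have eK (T : finGroupType) (theta : G -> T) :
    (forall x, A x -> theta x = 1 -> B x) ->
    B `&` [set x | theta x = 1] = A `&` [set x | theta x = 1].
  move=> kB; apply/seteqP; split=> x [] => [/sBA //|Ax x1].
  by split=> //; exact: kB.
pose chi x := (phi x, psi x).
have hchi : hom_on A chi by move=> x y Ax Ay; rewrite /chi hphi ?hpsi.
have hchiB := hom_onS sBA hchi.
have := multiplicity_image S (fst_morphism Q R) gA hchi.
have := multiplicity_image S (fst_morphism Q R) gB hchiB.
have := multiplicity_image S (snd_morphism Q R) gA hchi.
have := multiplicity_image S (snd_morphism Q R) gB hchiB.
rewrite /=.
rewrite (eK _ _ kphi) (eK _ _ kpsi) => -> -> eB eA.
move: eA eB.
set a := multiplicity S (image_group phi A).
set b := multiplicity S (image_group phi B).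
set c := multiplicity S (image_group psi A).
set d := multiplicity S (image_group psi B).
move: (multiplicity S _) (multiplicity S _) => k l eA eB.
by apply: (@addIn (k + l)); rewrite addnACA -eA eB addnACA (addnC l).
Qed.

Lemma conjg_iso_on (y : G) : iso_on [set: G] [set: G] (fun x => x ^ y).
Proof.
split=> [|x z _ _]; last exact: conjMg.
split=> // [x z _ _|x _]; first exact: conjg_inj.
by exists (x ^ y^-1); rewrite //= conjgKV.
Qed.

Definition conjugation (y : G) : virtual_aut G :=
  @VirtualAut G (fiT G) (fiT G) _ (conjg_iso_on y).

(** The intersection of all conjugates is the intersection of the finitely many
    conjugates by coset representatives, hence has finite index. *)
Lemma ex_normal_core (A : fiSubgroup G) : exists K : fiNormal G, K `<=` A.
Proof.
pose K : set G := [set x | forall g, fi_set A (x ^ g)].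
have gA := fi_subgroup A.
have gK : subgroup K.
  apply/subgroupP; split=> [g|x z Kx Kz g|x Kx g].
  - by rewrite conj1g; exact: subgroup1.
  - by rewrite conjMg; exact: subgroupM.
  - by rewrite conjVg; exact: subgroupV.
have nK : normal_subgroup K.
  by split=> // x h Kh g; rewrite -conjgM; exact: Kh.
have [s sP] := (finite_indexP gA).1 (fi_index A).
pose C := foldr (fun y B => fiI (va_preim (conjugation y) A) B) (fiT G) s.
have CA x y : fi_set C x -> y \in s -> fi_set A (x ^ y).
  rewrite /C; elim: s {sP C} => //= z s IHs [[_ Axz] Cx].
  by rewrite inE => /predU1P[-> //|]; exact: IHs.
have CK : fi_set C `<=` K.
  move=> x Cx g; have [y ys Ay] := sP g.
  have -> : x ^ g = (x ^ y) ^ (y^-1 * g) by rewrite -conjgM mulgA mulgV mul1g.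
  have Axy := CA x y Cx ys.
  rewrite conjgE; apply: subgroupM => //; first exact: subgroupV.
  exact: subgroupM.
have fK := finite_indexS CK (fi_subgroup C) gK (fi_index C).
by exists (FINormal nK fK) => x Kx; have := Kx 1; rewrite conjg1.
Qed.

Definition normal_core (A : fiSubgroup G) : fiNormal G :=
  projT1 (cid (ex_normal_core A)).

Lemma normal_core_sub (A : fiSubgroup G) : normal_core A `<=` A.
Proof. exact: (projT2 (cid (ex_normal_core A))). Qed.

Lemma hom_on_quot_pi (K : fiNormal G) (A : set G) : hom_on A (quot_pi K).
Proof. by move=> x y _ _; rewrite quot_piM. Qed.

Lemma quot_pi1 (K : fiNormal G) x : quot_pi K x = 1 <-> fin_set K x.
Proof.
split=> [/esym/quot_piP|Kx]; first by rewrite invg1 mul1g.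
by apply/esym/quot_piP; rewrite invg1 mul1g.
Qed.

Local Open Scope ring_scope.

(** The difference is an integer that may be negative: when A is not normal,
    S can occur more often in A/K than in G/K. *)
Definition factor_index (A : fiSubgroup G) : int :=
  (multiplicity S (image_group (quot_pi (normal_core A)) [set: G]))%:Z -
  (multiplicity S (image_group (quot_pi (normal_core A)) A))%:Z.

Lemma factor_indexE (A : fiSubgroup G) (Q : finGroupType) (phi : G -> Q) :
    hom_on [set: G] phi -> (forall x, phi x = 1%g -> fi_set A x) ->
  factor_index A = (multiplicity S (image_group phi [set: G]))%:Z -
                   (multiplicity S (image_group phi A))%:Z.
Proof.
move=> hphi kphi; apply/eqP.
rewrite /factor_index subr_eq addrAC eq_sym subr_eq -!PoszD; apply/eqP.
congr Posz; apply: multiplicity_exchange => //.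
- exact: subgroupT.
- exact: fi_subgroup.
- exact: hom_on_quot_pi.
- by move=> x _; exact: kphi.
- by move=> x _ /quot_pi1; exact: normal_core_sub.
Qed.

(** Let K be a normal subgroup of G inside both C and D.  The composite of f
    with G -> G/K is a homomorphism on A whose images of A and C are B/K and
    D/K, so the exchange lemma compares it on A with G -> G/K itself.  Its
    kernel need not be normal in G, which is why that lemma deals with
    homomorphisms defined on A only. *)
Lemma factor_index_iso (A B C D : fiSubgroup G) (f : G -> G) :
    iso_on A B f -> C `<=` A -> fi_set D = f @` C ->
  factor_index B - factor_index A = factor_index D - factor_index C.
Proof.
move=> fi sCA eD.
have [[fF _ fS] _] := fi.
have sDB : D `<=` B by rewrite eD => _ [x /sCA Ax <-]; exact: fF.
pose K := normal_core (fiI C D).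
have KC x : quot_pi K x = 1%g -> fi_set C x.
  by move=> /quot_pi1 Kx; have [] := normal_core_sub Kx.
have KD x : quot_pi K x = 1%g -> fi_set D x.
  by move=> /quot_pi1 Kx; have [] := normal_core_sub Kx.
have hK : hom_on [set: G] (quot_pi K) by exact: hom_on_quot_pi.
rewrite (factor_indexE hK KC) (factor_indexE hK KD).
rewrite (factor_indexE hK (fun x k => sCA x (KC x k))).
rewrite (factor_indexE hK (fun x k => sDB x (KD x k))).
pose psi := quot_pi K \o f.
have hpsi : hom_on A psi.
  by move=> x y Ax Ay; rewrite /psi /= (iso_onM fi) // hK.
have psiA : image_group psi A = image_group (quot_pi K) B.
  apply: eq_image_group; rewrite -[RHS]/(quot_pi K @` B) /psi -image_comp; congr (_ @` _).
  by apply/seteqP; split=> [_ [x Ax <-]|]; [exact: fF|exact: fS].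
have psiC : image_group psi C = image_group (quot_pi K) D.
  by apply: eq_image_group; rewrite eD image_comp.
have kpsi x : fi_set A x -> psi x = 1%g -> fi_set C x.
  move=> Ax /KD; rewrite eD => -[c Cc].
  by move/(iso_on_inj fi (sCA _ Cc) Ax) <-.
have := multiplicity_exchange (fi_subgroup A) (fi_subgroup C) sCA
          (@hom_on_quot_pi K A) hpsi (fun x _ => KC x) kpsi.
rewrite psiA psiC => /(congr1 Posz); rewrite !PoszD => e.
lia.
Qed.

End Independence.

(** * The integer character of the commensurator *)

Section Character.
Variables (S : finGroupType) (G : groupType).
Local Open Scope classical_set_scope.
Local Open Scope ring_scope.
Local Notation idx := (factor_index S).

Definition factor_ratio (a : Comm G) : int :=
  idx (va_cod (repr a)) - idx (va_dom (repr a)).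

Lemma factor_ratio_class (f : virtual_aut G) :
  factor_ratio (comm_class f) = idx (va_cod f) - idx (va_dom f).
Proof.
rewrite /factor_ratio; set g := repr _.
have /comm_classP[C [Cg Cf eqgf]] : comm_class g = comm_class f.
  exact: comm_reprK.
rewrite (factor_index_iso S (va_iso g) Cg (D := va_image Cg) erefl).
apply/esym; apply: (factor_index_iso S (va_iso f) Cf).
by apply/seteqP; split=> _ [x Cx <-]; exists x; rewrite ?eqgf.
Qed.

(** Restrict g and then f to the domain of the composite; the two differences
    then telescope. *)
Lemma factor_ratioM (a b : Comm G) :
  factor_ratio (a * b)%g = factor_ratio a + factor_ratio b.
Proof.
rewrite -(comm_reprK a) -(comm_reprK b) comm_classM !factor_ratio_class.
set f := repr a; set g := repr b.
have sDg : fi_set (va_preim g (va_dom f)) `<=` va_dom g by move=> x [].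
pose E := va_image sDg.
have sEf : E `<=` va_dom f by move=> _ [x [_ ?] <-].
rewrite (factor_index_iso S (va_iso f) sEf (D := va_cod (va_comp f g)) erefl).
rewrite (factor_index_iso S (va_iso g) sDg (D := E) erefl).
by rewrite addrA subrK.
Qed.

Lemma factor_ratio1 : factor_ratio 1%g = 0.
Proof. by apply: (@addrI _ (factor_ratio 1%g)); rewrite -factor_ratioM mulg1 addr0. Qed.

Lemma factor_ratioV (a : Comm G) : factor_ratio a^-1%g = - factor_ratio a.
Proof. by apply/eqP; rewrite -addr_eq0 -factor_ratioM mulVg factor_ratio1. Qed.

(** An automorphism has equal domain and codomain, and the kernel of a
    homomorphism is a subgroup. *)
Lemma factor_ratio_AComm (a : Comm G) : AComm G a -> factor_ratio a = 0.
Proof.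
apply: (@smallest_sub _ _ _ [set b | factor_ratio b = 0]).
  apply/subgroupP; split=> /= [|b c b0 c0|b b0].
  - exact: factor_ratio1.
  - by rewrite factor_ratioM b0 c0.
  - by rewrite factor_ratioV b0 oppr0.
move=> b [H _ [phi [phi_aut ->]]].
by rewrite /= factor_ratio_class subrr.
Qed.

Definition fiSubgroup_of_normal (U : fiNormal G) : fiSubgroup G :=
  FISubgroup (fin_normal U).1 (fin_index U).

Lemma factor_index_normal (U : fiNormal G) :
  idx (fiSubgroup_of_normal U) = comp_factors (quot U) S.
Proof.
have hU A := @hom_on_quot_pi G U A.
rewrite (factor_indexE (A := fiSubgroup_of_normal U) S (hU _) (fun x => (quot_pi1 U x).1)).
have -> : image_group (quot_pi U) [set: G] = [set: quot U]%G.
  apply/val_inj/setP => y; rewrite [RHS]inE; apply/mem_image_group => //.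
    exact: subgroupT.
  by exists (repr y) => //; exact: quot_reprK.
have -> : image_group (quot_pi U) (fiSubgroup_of_normal U) = 1%G.
  apply/val_inj/setP => y; rewrite [RHS]inE.
  have gU := (fin_normal U).1.
  apply/(mem_image_group _ gU (hU _))/eqP => [[x Ux <-]|->].
    exact/quot_pi1.
  by exists 1%g; [exact: subgroup1|apply/quot_pi1; exact: subgroup1].
by rewrite multiplicity1 subr0.
Qed.

End Character.

(** The preimage N of the multiples of 2 * chi(u) contains u^2 but not u, and
    u^2 is nontrivial because its image under chi is 2 * chi(u). *)
Lemma not_simple_of_int_character (H : groupType) (chi : H -> int) (u : H) :
  (forall a b, chi (a * b)%g = (chi a + chi b)%R) -> chi u != 0%R ->
  ~ simple_group H.
Proof.
move=> chiM chiu [_ simH].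
have chi1 : chi 1%g = 0%R by apply: (@addrI _ (chi 1%g)); rewrite -chiM mulg1 addr0.
have chiV a : chi a^-1%g = (- chi a)%R.
  by apply/eqP; rewrite -addr_eq0 -chiM mulVg chi1.
pose N : set H := [set a | (chi u *+ 2 %| chi a)%Z]%classic.
have nN : normal_subgroup N.
  split; last by move=> x h; rewrite /N /= conjgE !chiM chiV addrC addrK.
  apply/subgroupP; split; rewrite /N /=.
  - by rewrite chi1 dvdz0.
  - by move=> x y Nx Ny; rewrite chiM rpredD.
  - by move=> x Nx; rewrite chiV rpredN.
have [N1|NT] := simH _ nN.
  have : N (u * u)%g by rewrite /N /= chiM -mulr2n dvdzz.
  rewrite N1 => /= /(congr1 chi)/eqP.
  by rewrite chiM chi1 -mulr2n mulrn_eq0 (negPf chiu).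
have : N u by rewrite NT.
by rewrite /N /= -[X in (_ %| X)%Z]mulr1 -mulr_natr dvdz_mul2l.
Qed.

Theorem theorem5p5 (G : groupType)
  (fgG : finitely_generated G)
  (hcenter : virtual_center G = [set 1%g]%classic \/ unique_root_property G)
  (hquot : exists U V : fiNormal G,
     isomorphic U V /\ comp_factors (quot U) <> comp_factors (quot V)) :
  proper_subgroup (AComm G) /\ ~ simple_group (Comm G).
Proof.
have [U [V [[f fUV] neqUV]]] := hquot.
have [S neqS] : exists S, comp_factors (quot U) S <> comp_factors (quot V) S.
  apply: contrapT => eqUV; apply: neqUV; apply: funext => S.
  by apply: contrapT => neqS; apply: eqUV; exists S.
pose u : Comm G := comm_class (@VirtualAut G (fiSubgroup_of_normal U)
                                 (fiSubgroup_of_normal V) f fUV).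
have ratio_u : factor_ratio S u != 0%R.
  rewrite factor_ratio_class /= !factor_index_normal subr_eq0.
  by apply/eqP => -[/esym].
split; last exact: (not_simple_of_int_character (@factor_ratioM S G) ratio_u).
split; first exact: smallest_subgroup.
split=> // /(_ u I)/(factor_ratio_AComm S) u0.
by rewrite u0 eqxx in ratio_u.
Qed.
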